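(* Let $G$ be a graph having three or four components. Then $G$ is niche-realizable if and only if each of its components is complete.
   Context: All graphs are simple. A bipartite tournament is an orientation of a complete bipartite graph. The niche graph of a digraph $D$ is the graph with vertex set $V(D)$ in which distinct $u,v$ are adjacent iff there is a vertex $w$ with $(u,w),(v,w)\in A(D)$, or with $(w,u),(w,v)\in A(D)$. A graph is niche-realizable if it is the niche graph of some bipartite tournament. *)

(* Defs.v *)
From HB Require Import structures.
From mathcomp Require Import all_boot.

Set Implicit Arguments.
Unset Strict Implicit.
Unset Printing Implicit Defensive.

Record sgraph (T : finType) := SGraph {
  sedge :> rel T;
  sedge_sym : symmetric sedge;
  sedge_irr : irreflexive sedge
}.

Section Defs.
Variable T : finType.

Definition components (G : sgraph T) : {set {set T}} :=
  equivalence_partition (connect G) [set: T].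

Definition complete_on (G : sgraph T) (C : {set T}) : Prop :=
  {in C &, forall u v, u != v -> G u v}.

(* Both partite sets, X and its complement, are required to be nonempty. *)
Definition complete_bipartite (G : sgraph T) : Prop :=
  exists X : {set T}, [/\ X != set0, ~: X != set0 &
    forall u v, G u v = ((u \in X) != (v \in X))].

(* A digraph on T is its arc relation: D u v holds iff (u, v) is an arc. *)
Definition orientation (D : rel T) (G : sgraph T) : Prop :=
  (forall u v, D u v -> ~~ D v u) /\
  (forall u v, G u v = D u v || D v u).

Definition bipartite_tournament (D : rel T) : Prop :=
  exists2 G : sgraph T, complete_bipartite G & orientation D G.

Definition niche_rel (D : rel T) : rel T := fun u v =>
  (u != v) && [exists w, (D u w && D v w) || (D w u && D w v)].

Lemma niche_rel_sym (D : rel T) : symmetric (niche_rel D).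
Proof.
move=> u v; rewrite /niche_rel eq_sym; congr (_ && _).
by apply: eq_existsb => w; rewrite andbC [D w u && _]andbC.
Qed.

Lemma niche_rel_irr (D : rel T) : irreflexive (niche_rel D).
Proof. by move=> u; rewrite /niche_rel eqxx. Qed.

Definition niche_graph (D : rel T) : sgraph T :=
  SGraph (niche_rel_sym D) (niche_rel_irr D).

(* A bipartite tournament can be transported along a graph isomorphism, so it
   is enough to consider tournaments on the vertex set of G itself. *)
Definition niche_realizable (G : sgraph T) : Prop :=
  exists2 D : rel T, bipartite_tournament D & G =2 niche_graph D.

End Defs.

(* Main.v *)
Require Import Defs.
From HB Require Import structures.
From mathcomp Require Import all_boot.

Set Implicit Arguments.
Unset Strict Implicit.
Unset Printing Implicit Defensive.

(** Two vertices on the same side of a bipartite tournament are non-adjacent in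
    the niche graph exactly when their out-neighbourhoods are complementary in
    the other side.  Hence each side meets at most two components, and with three
    or more components some side meets two.  The vertices of that side then have
    exactly two out-neighbourhoods, complementary to each other, so those of the
    other side have at most two, again complementary: all components are cliques.
    Conversely, cliques [A], [B], [C], [R] (the last one possibly empty) form the
    niche graph of the blown-up 4-cycle [A -> C -> B -> R -> A]. *)

Section Components.
Variables (T : finType) (G : sgraph T).

Lemma sgraph_connect_sym : connect_sym G.
Proof. exact: sym_connect_sym (sedge_sym G). Qed.

Definition component (x : T) : {set T} := [set y in [set: T] | connect G x y].

Lemma componentsE : components G = [set component x | x in [set: T]].
Proof. by []. Qed.

Lemma mem_component x : component x \in components G.
Proof. by rewrite componentsE imset_f. Qed.

Lemma eq_component x y : (component x == component y) = connect G x y.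
Proof.
apply/eqP/idP=> [/setP/(_ y)|xy]; first by rewrite !inE connect0.
by apply/setP=> z; rewrite !inE (same_connect sgraph_connect_sym xy).
Qed.

Lemma components_completeP :
  (forall C, C \in components G -> complete_on G C) <->
  (forall u v, u != v -> connect G u v -> G u v).
Proof.
split=> [cpl u v uv cuv|cpl C].
  by apply: (cpl _ (mem_component u)); rewrite ?inE ?connect0.
rewrite componentsE => /imsetP[x _ ->] u v; rewrite !inE /= => xu xv uv.
by apply: cpl => //; rewrite -(same_connect sgraph_connect_sym xu).
Qed.

Lemma three_components : 2 < #|components G| ->
  exists a b c, [/\ ~~ connect G a b, ~~ connect G b c & ~~ connect G c a].
Proof.
case/card_gt2P=> A [B [C [[]]]]; rewrite componentsE.
move=> /imsetP[a _ ->] /imsetP[b _ ->] /imsetP[c _ ->].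
by rewrite !eq_component => -[ab bc ca]; exists a, b, c.
Qed.

Lemma pairwise_disconnected_size (s : seq T) :
  pairwise (fun x y => ~~ connect G x y) s -> size s <= #|components G|.
Proof.
move=> s_pw; rewrite -(size_map component) -(card_uniqP _).
  by apply/subset_leq_card/subsetP=> _ /mapP[x _ ->]; apply: mem_component.
rewrite uniq_pairwise pairwise_map; apply: sub_pairwise s_pw => x y /=.
by rewrite eq_component.
Qed.

End Components.

Section NicheGraphComplete.
Variables (T : finType) (D : rel T) (X : {set T}).
Let side (x : T) := x \in X.
Hypothesis D_side : forall u v, side u = side v -> ~~ D u v.
Hypothesis D_cross : forall u v, side u != side v -> D v u = ~~ D u v.
Let G := niche_graph D.

(** Across the sides exactly one of the two arcs is present, so a common in-neighbour is a vertex at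
    which both out-arcs are absent. Both clauses of niche adjacency thus become agreement of the
    out-arcs at some [w] on the opposite side. *)
Lemma nicheP u v : reflect
  (u != v /\ exists w, [/\ side u != side w, side v != side w & D u w = D v w])
  (G u v).
Proof.
apply: (iffP andP) => -[uv].
  have cross a b : D a b -> side a != side b.
    by apply: contraL => /eqP; apply: D_side.
  case/existsP=> w /orP[] /andP[uw vw]; split=> //; exists w.
    by rewrite !cross // uw vw.
  have [wu wv] := (cross _ _ uw, cross _ _ vw).
  by rewrite !(@D_cross w) // uw vw !(eq_sym _ (side w)).
case=> w [uw vw eq_w]; split=> //; apply/existsP; exists w.
by rewrite (@D_cross u w) // (@D_cross v w) // -eq_w !andbb orbN.
Qed.

(** The witness [w] of an edge lies opposite to both ends, so no edge leaves a side. *)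
Lemma niche_connect_side u v : connect G u v -> side u = side v.
Proof.
apply: (@closed_connect _ G side) => x y /nicheP[_ [w []]].
by rewrite unfold_in /side /=; case: (x \in X) (y \in X) (w \in X) => [] [] [].
Qed.

Lemma disconnected_opposite u v w : side u = side v -> side u != side w ->
  ~~ connect G u v -> D v w = ~~ D u w.
Proof.
move=> uv uw; apply: contraNeq => neq; have [->|nuv] := eqVneq u v => //.
apply/connect1/nicheP; split=> //; exists w; rewrite -uv; split=> //.
by case: (D u w) (D v w) neq => [] [].
Qed.

Section TwoComponentsOnOneSide.
Variables y y' : T.
Hypotheses (yy' : side y = side y') (ncyy' : ~~ connect G y y').

(** Induction along a path from [x] to [z]. An edge only gives agreement at some [w] on the side of
    [y]; the pair [y], [y'] transfers it to [y]. *)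
Lemma arc_to_invariant x z : side x != side y -> connect G x z -> D x y = D z y.
Proof.
have rev a b : side a != side b -> D a b = ~~ D b a.
  by rewrite eq_sym; apply: D_cross.
move=> xy cxz; have sxz := niche_connect_side cxz.
have step a b : side a = side x -> G a b -> D a y = D b y.
  move=> ax /nicheP[_ [w [aw bw eq_w]]].
  have yw : side y = side w.
    by move: xy aw; rewrite ax; case: (side x) (side y) (side w) => [] [] [].
  have bx : side b = side x.
    by move: xy bw; rewrite yw; case: (side b) (side x) (side w) => [] [] [].
  have swap p q t : side t = side x -> side p = side y -> side q = side y ->
      ~~ connect G p q -> D t p = ~~ D t q.
    move=> tx py qy pq; rewrite (rev t p) ?(rev t q) ?tx ?py ?qy //.
    by rewrite (@disconnected_opposite p q) ?negbK ?py ?qy ?tx // eq_sym.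
  (* If [w] is connected to [y], both are disconnected from [y'], and two negations through [y']
     give [D t y = D t w]. Otherwise [D t y] is the negation of [D t w]. Either way agreement at [w]
     yields agreement at [y]. *)
  have [yw_c|ncyw] := boolP (connect G y w).
    have ncwy' : ~~ connect G y' w.
      apply: contra ncyy' => y'w; apply: connect_trans yw_c _.
      by rewrite sgraph_connect_sym.
    have via t : side t = side x -> D t y = D t w.
      by move=> tx; rewrite (swap y y') // (swap y' w) ?negbK.
    by rewrite !via.
  by rewrite (swap y w a) // (swap y w b) // eq_w.
have /connectP[p] := cxz; elim: p x {xy cxz} sxz step => [|t p IHp] x sxz step /=.
  by move=> _ ->.
case/andP=> xt tp zE.
have xt_side := niche_connect_side (connect1 xt).
by rewrite (step x t) //; apply: IHp; rewrite -?xt_side.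
Qed.

(** By invariance, [y] itself is a common witness. *)
Lemma complete_on_other_side u v :
  side u != side y -> u != v -> connect G u v -> G u v.
Proof.
move=> uy uv cuv; apply/nicheP; split=> //; exists y.
by rewrite -(niche_connect_side cuv) (arc_to_invariant uy cuv).
Qed.

(** One of [y], [y'] is disconnected from [u], hence from [v]. The out-neighbourhoods of [u] and [v]
    are both complementary to that of this vertex, so they agree everywhere, in particular at
    [x]. *)
Lemma complete_on_same_side u v (x : T) : side x != side y ->
  side u = side y -> u != v -> connect G u v -> G u v.
Proof.
move=> xy uy uv cuv; have suv := niche_connect_side cuv.
apply/nicheP; split=> //; exists x; rewrite -suv uy eq_sym; split=> //.
have ncu : ~~ (connect G u y && connect G u y').
  apply: contra ncyy' => /andP[cy]; apply: connect_trans.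
  by rewrite sgraph_connect_sym.
have key z : side z = side y -> ~~ connect G u z -> D u x = D v x.
  move=> zy ncuz.
  have ncvz : ~~ connect G v z.
    by apply: contra ncuz; apply: connect_trans.
  apply: (can_inj negbK).
  rewrite -(@disconnected_opposite u z x) -?(@disconnected_opposite v z x) //;
    by rewrite -?suv ?uy ?zy // eq_sym.
by move: ncu; rewrite negb_and => /orP[]; apply: key.
Qed.

End TwoComponentsOnOneSide.

Lemma niche_connected_adjacent : (forall y, exists x, side x != side y) ->
  2 < #|components G| -> forall u v, u != v -> connect G u v -> G u v.
Proof.
move=> other /three_components[a [b [c [ab bc ca]]]] u v uv cuv.
have done y y' : side y = side y' -> ~~ connect G y y' -> G u v.
  move=> yy' ncyy'; have [uy|uy] := eqVneq (side u) (side y).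
    by have [x xy] := other y; apply: (@complete_on_same_side y y' _ ncyy' u v x).
  exact: (@complete_on_other_side y y').
(* Pigeonhole: two of [a], [b], [c] share a side. *)
have [|nab] := eqVneq (side a) (side b); first by move/done; apply.
have [|nbc] := eqVneq (side b) (side c); first by move/done; apply.
apply: (done c a) => //.
by move: nab nbc; case: (side a) (side b) (side c) => [] [] [].
Qed.

End NicheGraphComplete.

Lemma bipartite_tournament_sides (T : finType) (D : rel T) :
  bipartite_tournament D -> exists X : {set T},
  [/\ forall u v, (u \in X) = (v \in X) -> ~~ D u v,
      forall u v, (u \in X) != (v \in X) -> D v u = ~~ D u v &
      forall y, exists x, (x \in X) != (y \in X)].
Proof.
case=> B [X [/set0Pn[a aX] /set0Pn[b]]]; rewrite inE => bX BE [asym orient].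
exists X; split=> [u v uv|u v uv|y].
- have: ~~ B u v by rewrite BE uv eqxx.
  by rewrite orient negb_or => /andP[].
- have := BE u v; rewrite uv orient; have := asym u v.
  by case: (D u v) (D v u) => [] [] // /(_ isT).
have [yX|yX] := boolP (y \in X); first by exists b; rewrite (negbTE bX).
by exists a; rewrite aX.
Qed.

Section FourCycleBlowUp.
Variables (T : finType) (A B C : pred T).
Hypotheses (AB : forall x, ~~ (A x && B x)) (BC : forall x, ~~ (B x && C x))
  (CA : forall x, ~~ (C x && A x)).
Variables a c : T.
Hypotheses (Aa : A a) (Cc : C c).

Let R : pred T := fun x => ~~ [|| A x, B x | C x].

(** The sides are [A] with [B] and [C] with [R]. The two classes of a side have complementary
    out-neighbourhoods, so they are not joined in the niche graph. *)
Definition cycle4_arc : rel T := fun u v =>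
  [|| A u && C v, C u && B v, B u && R v | R u && A v].

Lemma cycle4_bipartite_tournament : bipartite_tournament cycle4_arc.
Proof.
pose X := [set x | A x || B x].
have sym : symmetric (fun u v => (u \in X) != (v \in X)).
  by move=> u v; rewrite eq_sym.
have irr : irreflexive (fun u v => (u \in X) != (v \in X)).
  by move=> u; rewrite eqxx.
exists (SGraph sym irr).
  exists X; split=> //; apply/set0Pn; first by exists a; rewrite inE Aa.
  exists c; rewrite !inE.
  by move: (BC c) (CA c); rewrite Cc; case: (A c) (B c) => [] [].
split=> u v /=; rewrite /cycle4_arc /R ?inE;
  move: (AB u) (BC u) (CA u) (AB v) (BC v) (CA v);
  by case: (A u) (B u) (C u) (A v) (B v) (C v) => [] [] [] [] [] [].
Qed.

Lemma cycle4_niche u v : niche_graph cycle4_arc u v =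
  (u != v) && [&& A u == A v, B u == B v & C u == C v].
Proof.
congr (_ && _); apply/existsP/idP=> [[w]|].
  move: (AB w) (BC w) (CA w) (AB u) (BC u) (CA u) (AB v) (BC v) (CA v).
  rewrite /cycle4_arc /R.
  case: (A w) (B w) (C w) => [] [] [] //= _ _ _;
    by case: (A u) (B u) (C u) (A v) (B v) (C v) => [] [] [] [] [] [].
case/and3P=> /eqP Auv /eqP Buv /eqP Cuv.
(* Any vertex of the opposite side would do, since its arcs to a class all point the same way; [c]
   and [a] are the ones known to exist. *)
exists (if A u || B u then c else a).
move: (AB u) (BC u) (CA u) (AB a) (BC c) (CA a) (CA c).
rewrite /cycle4_arc /R -Auv -Buv -Cuv; case: ifP; rewrite ?Aa ?Cc;
  by case: (A u) (B u) (C u) (B a) (C a) (A c) (B c) => [] [] [] [] [] [] [].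
Qed.

End FourCycleBlowUp.

Lemma complete_components_niche_realizable (T : finType) (G : sgraph T) :
  2 < #|components G| -> #|components G| <= 4 ->
  (forall u v, u != v -> connect G u v -> G u v) -> niche_realizable G.
Proof.
move=> /three_components[a [b [c [ab bc ca]]]] le4 cpl.
have excl x y z : ~~ connect G x y -> ~~ (connect G x z && connect G y z).
  by apply: contra => /andP[xz]; rewrite sgraph_connect_sym; apply: connect_trans.
have AB := excl a b ^~ ab; have BC := excl b c ^~ bc; have CA := excl c a ^~ ca.
exists (cycle4_arc (connect G a) (connect G b) (connect G c)).
  exact: (cycle4_bipartite_tournament AB BC CA (connect0 _ a) (connect0 _ c)).
move=> u v.
rewrite (cycle4_niche AB BC CA (connect0 _ a) (connect0 _ c)).
have [->|uv] /= := eqVneq u v; first exact: sedge_irr.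
apply/idP/and3P=> [Guv|].
  have same x : connect G x u == connect G x v.
    have csym := sgraph_connect_sym G.
    by rewrite !(csym x) (same_connect csym (connect1 Guv)).
  by split; apply: same.
case=> /eqP au /eqP bu /eqP cu; apply: cpl => //.
have via x : connect G x u -> connect G x u = connect G x v -> connect G u v.
  move=> xu; rewrite xu => xv; apply: connect_trans (esym xv).
  by rewrite sgraph_connect_sym.
have [/via/(_ au)//|nau] := boolP (connect G a u).
have [/via/(_ bu)//|nbu] := boolP (connect G b u).
have [/via/(_ cu)//|ncu] := boolP (connect G c u).
(* Here [u] and [v] both lie outside the components of [a], [b] and [c]. Were they disconnected,
   these five vertices would give five components, so what remains is a single clique. *)
apply: contraLR le4 => nuv; rewrite -ltnNge.
apply: (@pairwise_disconnected_size _ G [:: a; b; c; u; v]).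
rewrite /= -au -bu -cu ab bc nau nbu ncu nuv.
by rewrite sgraph_connect_sym ca.
Qed.

Theorem theorem3p4 (T : finType) (G : sgraph T)
    (hG : #|components G| = 3 \/ #|components G| = 4) :
  niche_realizable G <->
  (forall C : {set T}, C \in components G -> complete_on G C).
Proof.
have [gt2 le4] : 2 < #|components G| /\ #|components G| <= 4.
  by case: hG => ->.
apply: iff_trans (iff_sym (components_completeP G)).
split; last exact: complete_components_niche_realizable.
case=> D /bipartite_tournament_sides[X [D_side D_cross other]] GE u v uv.
have componentsGE : components G = components (niche_graph D).
  by apply: eq_imset => x; apply/setP=> y; rewrite !inE (eq_connect GE).
rewrite (eq_connect GE) GE.
by apply: (niche_connected_adjacent D_side D_cross); rewrite -?componentsGE.
Qed.
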